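(* Let $n\ge 1$ and let $A,B,C,D\in\{\pm1\}^n$ be binary sequences of length $n$. Then $(A,B,C,D)$ is a quadruple of QT sequences if and only if $(A,B,C,D)$ is a quadruple of Williamson-type sequences.
   Context: For sequences $X=[x_0,\dots,x_{n-1}]$ and $Y=[y_0,\dots,y_{n-1}]$ with entries in $\{\pm1\}$ and $0\le t<n$, the periodic crosscorrelation is $R_{X,Y}(t)=\sum_{r=0}^{n-1}x_r\,y_{(r+t)\bmod n}$, and the periodic autocorrelation is $R_X(t)=R_{X,X}(t)$. Let $\delta_{0,t}$ be the Kronecker delta. A quadruple $(A,B,C,D)$ of $\{\pm1\}$-sequences of length $n$ is a quadruple of QT sequences if for all $0\le t<n$: (1) $R_A(t)+R_B(t)+R_C(t)+R_D(t)=4n\,\delta_{0,t}$; (2) $R_{A,B}(t)-R_{B,A}(t)+R_{C,D}(t)-R_{D,C}(t)=0$; (3) $R_{A,C}(t)-R_{C,A}(t)+R_{D,B}(t)-R_{B,D}(t)=0$; (4) $R_{A,D}(t)-R_{D,A}(t)+R_{B,C}(t)-R_{C,B}(t)=0$. It is a quadruple of Williamson-type sequences if for all $0\le t<n$ condition (1) holds and $R_{X,Y}(t)-R_{Y,X}(t)=0$ for all $X,Y\in\{A,B,C,D\}$. *)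

(* Defs.v *)
From mathcomp Require Import all_boot all_order all_algebra.

Set Implicit Arguments.
Unset Strict Implicit.
Unset Printing Implicit Defensive.

Import GRing.Theory Num.Theory.
Local Open Scope ring_scope.

Definition binary_seq (n : nat) (X : n.-tuple int) : Prop :=
  forall r : 'I_n, tnth X r = 1 \/ tnth X r = -1.

(* The default value of nth is never used: r < n implies (r + t) %% n < n. *)
Definition crosscorr (n : nat) (X Y : n.-tuple int) (t : nat) : int :=
  \sum_(r < n) nth 0 X r * nth 0 Y ((r + t) %% n)%N.

Definition autocorr (n : nat) (X : n.-tuple int) (t : nat) : int :=
  crosscorr X X t.

Definition kronecker_delta (s t : nat) : int := (s == t)%:R.

Definition complementary_at (n : nat) (A B C D : n.-tuple int) (t : nat) :
    Prop :=
  autocorr A t + autocorr B t + autocorr C t + autocorr D t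
    = 4 * n%:Z * kronecker_delta 0 t.

(* The entries are not required to be +1 or -1 in the next two definitions;
   they are meant for quadruples of sequences satisfying binary_seq. *)
Definition QT_sequences (n : nat) (A B C D : n.-tuple int) : Prop :=
  forall t : nat, (t < n)%N ->
  [/\ complementary_at A B C D t,
      crosscorr A B t - crosscorr B A t
        + crosscorr C D t - crosscorr D C t = 0,
      crosscorr A C t - crosscorr C A t
        + crosscorr D B t - crosscorr B D t = 0
    & crosscorr A D t - crosscorr D A t
        + crosscorr B C t - crosscorr C B t = 0].

Definition Williamson_type_sequences (n : nat) (A B C D : n.-tuple int) :
    Prop :=
  forall t : nat, (t < n)%N ->
  complementary_at A B C D t /\
  (forall X Y : n.-tuple int,
     X \in [:: A; B; C; D] -> Y \in [:: A; B; C; D] ->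
     crosscorr X Y t - crosscorr Y X t = 0).

(* Main.v *)
Require Import Defs.
From HB Require Import structures.
From mathcomp Require Import all_boot all_order all_algebra ring.

(** At a character of the cyclic group let x, y in R^4 be the real and imaginary
    parts of the Fourier transforms of (A, B, C, D).  The antisymmetrized
    crosscorrelations are the Pluecker coordinates of the bivector x /\ y, and
    QT conditions (2)-(4) say that its self-dual part vanishes.  A decomposable
    bivector has self-dual and anti-self-dual parts of equal norm, so x /\ y = 0.
    The same computation works without characters: in the commutative group ring
    Z[Z/n] the Pluecker relation turns (2)-(4) into P^2 + Q^2 + R^2 = 0, where
    P, Q, R are the antisymmetrized crosscorrelations of A with B, C, D.  As P,
    Q, R are odd functions, the coefficient of this identity at 0 is minus the
    sum of the squares of all their values. *)

Set Implicit Arguments.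
Unset Strict Implicit.
Unset Printing Implicit Defensive.

Import GRing.Theory Num.Theory.
Local Open Scope ring_scope.

(* An alias of {ffun G -> R}, which already carries the pointwise product. *)
Definition group_ring (R : comPzRingType) (G : finZmodType) : Type :=
  {ffun G -> R}.

HB.instance Definition _ (R : comPzRingType) (G : finZmodType) :=
  GRing.Zmodule.copy (group_ring R G) {ffun G -> R}.

Section GroupRing.
Variables (R : comPzRingType) (G : finZmodType).
Implicit Types f g h : group_ring R G.

Definition gr_coef f (x : G) : R := (f : {ffun G -> R}) x.

Definition gr_of (F : G -> R) : group_ring R G := [ffun x => F x].

Definition gr_mul f g := gr_of (fun x => \sum_y gr_coef f y * gr_coef g (x - y)).

Definition gr_one := gr_of (fun x => (x == 0)%:R).

Lemma gr_coef_of F x : gr_coef (gr_of F) x = F x.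
Proof. by rewrite /gr_coef ffunE. Qed.

Lemma gr_coefD f g x : gr_coef (f + g) x = gr_coef f x + gr_coef g x.
Proof. by rewrite /gr_coef ffunE. Qed.

Lemma gr_coefN f x : gr_coef (- f) x = - gr_coef f x.
Proof. by rewrite /gr_coef ffunE. Qed.

Lemma gr_coef0 x : gr_coef 0 x = 0.
Proof. by rewrite /gr_coef ffunE. Qed.

Lemma gr_eqP f g : gr_coef f =1 gr_coef g -> f = g.
Proof. by move=> eq_fg; apply/ffunP. Qed.

Lemma gr_mulC : commutative gr_mul.
Proof.
move=> f g; apply: gr_eqP => x; rewrite !gr_coef_of.
rewrite (reindex_inj (inv_inj (subKr x))) /=.
by apply: eq_bigr => y _; rewrite subKr mulrC.
Qed.

Lemma gr_mulA : associative gr_mul.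
Proof.
move=> f g h; apply: gr_eqP => x; rewrite !gr_coef_of.
under eq_bigr => y _ do rewrite gr_coef_of big_distrr /=.
under [RHS]eq_bigr => y _ do rewrite gr_coef_of big_distrl /=.
rewrite [RHS]exchange_big /=; apply: eq_bigr => y _.
rewrite [RHS](reindex_inj (addrI y)) /=; apply: eq_bigr => z _.
by rewrite mulrA [y + z - y]addrC addKr opprD addrA.
Qed.

Lemma gr_mul1 : left_id gr_one gr_mul.
Proof.
move=> f; apply: gr_eqP => x; rewrite gr_coef_of (bigD1 0) //=.
rewrite gr_coef_of eqxx mul1r subr0 big1 ?addr0 // => y /negPf y0.
by rewrite gr_coef_of y0 mul0r.
Qed.

Lemma gr_mulDl : left_distributive gr_mul +%R.
Proof.
move=> f g h; apply: gr_eqP => x; rewrite gr_coefD !gr_coef_of -big_split /=.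
by apply: eq_bigr => y _; rewrite gr_coefD mulrDl.
Qed.

HB.instance Definition _ :=
  GRing.Zmodule_isComPzRing.Build (group_ring R G)
    gr_mulA gr_mulC gr_mul1 gr_mulDl.

Lemma gr_coefM f g x :
  gr_coef (f * g) x = \sum_y gr_coef f y * gr_coef g (x - y).
Proof. exact: gr_coef_of. Qed.

Definition gr_star f := gr_of (fun x => gr_coef f (- x)).

(** Writing a correlation as a product turns relations between correlations into polynomial
    identities, with the stars as extra variables. *)
Definition gr_corr f g := gr_star f * g.

Lemma gr_coef_corr f g x :
  gr_coef (gr_corr f g) x = \sum_y gr_coef f y * gr_coef g (y + x).
Proof.
rewrite gr_coefM (reindex_inj oppr_inj); apply: eq_bigr => y _ /=.
by rewrite gr_coef_of !opprK [x + y]addrC.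
Qed.

Lemma gr_coef_corr_opp f g x :
  gr_coef (gr_corr f g) (- x) = gr_coef (gr_corr g f) x.
Proof.
rewrite !gr_coef_corr (reindex_inj (addIr x)); apply: eq_bigr => y _ /=.
by rewrite addrK mulrC.
Qed.

Definition gr_skew f g := gr_corr f g - gr_corr g f.

Lemma gr_coef_skew_opp f g x :
  gr_coef (gr_skew f g) (- x) = - gr_coef (gr_skew f g) x.
Proof. by rewrite !gr_coefD !gr_coefN !gr_coef_corr_opp opprB. Qed.

Lemma gr_skewC f g : gr_skew g f = - gr_skew f g.
Proof. by rewrite opprB. Qed.

(** [gr_skew a b] is the minor on columns a, b of the 2 x 4 matrix whose first row holds the stars
    of a, b, c, d and whose second row is a, b, c, d. The three-term relation between such minors
    holds in any commutative ring. *)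
Lemma gr_skew_plucker a b c d :
  gr_skew a b * gr_skew c d + gr_skew a c * gr_skew d b
    + gr_skew a d * gr_skew b c = 0.
Proof. by rewrite /gr_skew /gr_corr; ring. Qed.

Lemma gr_coef_skew_sqr0 f g :
  gr_coef (gr_skew f g * gr_skew f g) 0
    = - \sum_x gr_coef (gr_skew f g) x ^+ 2.
Proof.
rewrite gr_coefM -sumrN; apply: eq_bigr => x _.
by rewrite sub0r gr_coef_skew_opp mulrN expr2.
Qed.

End GroupRing.

Section RealCoefficients.
Variables (R : realDomainType) (G : finZmodType).
Implicit Types a b c d : group_ring R G.

(** Positivity enters here: at 0, oddness makes the left-hand side minus a sum of squares in an
    ordered domain, so every coefficient vanishes. *)
Lemma gr_skew_sqr_sum_eq0 a b c d :
  gr_skew a b * gr_skew a b + gr_skew a c * gr_skew a c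
    + gr_skew a d * gr_skew a d = 0 ->
  [/\ gr_skew a b = 0, gr_skew a c = 0 & gr_skew a d = 0].
Proof.
move=> /(congr1 (fun f => gr_coef f 0)).
rewrite !gr_coefD !gr_coef_skew_sqr0 gr_coef0 -!opprD => /eqP.
have sum_ge0 f : 0 <= \sum_x gr_coef f x ^+ 2 :> R.
  by apply: sumr_ge0 => x _; apply: sqr_ge0.
have sum_eq0 (f : group_ring R G) : \sum_x gr_coef f x ^+ 2 == 0 -> f = 0.
  rewrite psumr_eq0 => [/allP f0|x _]; last exact: sqr_ge0.
  apply: gr_eqP => x; apply/eqP.
  by rewrite gr_coef0 -(sqrf_eq0 (gr_coef f x)); apply: f0; rewrite mem_index_enum.
rewrite oppr_eq0 !paddr_eq0 ?addr_ge0 // -andbA => /and3P[ab ac ad].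
by split; apply: sum_eq0.
Qed.

Lemma gr_skew_selfdual_eq0 a b c d :
    gr_skew a b + gr_skew c d = 0 ->
    gr_skew a c + gr_skew d b = 0 ->
    gr_skew a d + gr_skew b c = 0 ->
  [/\ gr_skew a b = 0, gr_skew a c = 0, gr_skew a d = 0
    & [/\ gr_skew c d = 0, gr_skew d b = 0 & gr_skew b c = 0]].
Proof.
move=> /addr0_eq cd /addr0_eq db /addr0_eq bc.
have := gr_skew_plucker a b c d.
(* Each product in the Pluecker relation becomes minus a square. *)
rewrite -cd -db -bc !mulrN -!opprD => /eqP.
rewrite oppr_eq0 => /eqP /gr_skew_sqr_sum_eq0[-> -> ->].
by rewrite oppr0.
Qed.

End RealCoefficients.

(** The successor length makes the index type ['I_m.+1] the cyclic group of order m + 1. *)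
Definition gr_of_tuple (m : nat) (X : m.+1.-tuple int) :
    group_ring int 'I_m.+1 :=
  gr_of (fun i : 'I_m.+1 => nth 0 X i).

Lemma crosscorr_skewE m (X Y : m.+1.-tuple int) (t : 'I_m.+1) :
  crosscorr X Y t - crosscorr Y X t
    = gr_coef (gr_skew (gr_of_tuple X) (gr_of_tuple Y)) t.
Proof.
rewrite gr_coefD gr_coefN !gr_coef_corr.
(* Addition in ['I_m.+1] computes to addition modulo m + 1, so the shifted indices agree by
   conversion. *)
by congr (_ - _); apply: eq_bigr => r _; rewrite !gr_coef_of.
Qed.

Lemma crosscorr_skew_addE m (X Y Z W : m.+1.-tuple int) :
  (forall t, (t < m.+1)%N -> crosscorr X Y t - crosscorr Y X t
     + crosscorr Z W t - crosscorr W Z t = 0) ->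
  gr_skew (gr_of_tuple X) (gr_of_tuple Y)
    + gr_skew (gr_of_tuple Z) (gr_of_tuple W) = 0.
Proof.
move=> XYZW; apply: gr_eqP => t.
by rewrite gr_coefD -!crosscorr_skewE gr_coef0 addrA XYZW.
Qed.

Theorem theorem9 (n : nat) (hn : (1 <= n)%N) (A B C D : n.-tuple int)
    (hA : binary_seq A) (hB : binary_seq B)
    (hC : binary_seq C) (hD : binary_seq D) :
  QT_sequences A B C D <-> Williamson_type_sequences A B C D.
Proof.
split=> [qt | wt t lt_tn]; last first.
  have [compl skew0] := wt t lt_tn.
  by split=> //; rewrite -addrA !skew0 ?addr0 // !inE eqxx ?orbT.
case: n hn A B C D hA hB hC hD qt => // m _ A B C D _ _ _ _ qt.
have cd := crosscorr_skew_addE (fun t lt => let: And4 _ h _ _ := qt t lt in h).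
have db := crosscorr_skew_addE (fun t lt => let: And4 _ _ h _ := qt t lt in h).
have bc := crosscorr_skew_addE (fun t lt => let: And4 _ _ _ h := qt t lt in h).
have [ab0 ac0 ad0 [cd0 db0 bc0]] := gr_skew_selfdual_eq0 cd db bc.
move=> t lt_tm; split=> [|X Y]; first by case: (qt t lt_tm).
rewrite (crosscorr_skewE X Y (Ordinal lt_tm)).
suff skew0 : X \in [:: A; B; C; D] -> Y \in [:: A; B; C; D] ->
    gr_skew (gr_of_tuple X) (gr_of_tuple Y) = 0.
  by move=> XS YS; rewrite skew0 // gr_coef0.
(* Of the sixteen pairs, the diagonal ones cancel; the others are one of the six vanishing elements
   or its opposite. *)
rewrite !inE => /or4P[] /eqP-> /or4P[] /eqP->; try exact: subrr; first
  [ by rewrite ?(ab0, ac0, ad0, cd0, db0, bc0)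
  | by rewrite gr_skewC ?(ab0, ac0, ad0, cd0, db0, bc0) oppr0 ].
Qed.
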